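(* Let $n\ge1$ and let $G=([n],E)$ be the communication graph of $n$ space-time points, as defined in the context. Let $\mathcal{G}_1$ be the game in which player $\mathcal{P}_j$ ($j\in[n]$) receives the challenge $c_j$ and must issue a response $r_j$, the allowed communication between players being specified by $G$. Let $\mathcal{G}_2$ be the game in which player $\mathcal{P}_j$ receives the challenges $\{c_k\}_{k\in\mathcal{S}_j}$, where $$\mathcal{S}_j:=\{j\}\cup\{k\in[n]:(k,j)\in E\},$$ must issue a response $r_j$, and no communication between players is allowed. Then the sets of strategies available to classical players in $\mathcal{G}_1$ and in $\mathcal{G}_2$ are identical. That is, a tuple of functions $(F_1,\dots,F_n)$, with $F_j$ giving the response $r_j=F_j(c_1,\dots,c_n)$ as a function of all challenges, is realizable by a deterministic strategy in $\mathcal{G}_1$ if and only if it is realizable by a deterministic strategy in $\mathcal{G}_2$.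
   Context: $[n]=\{1,\dots,n\}$. Communication graph. Let $(x_1,t_1),\dots,(x_n,t_n)\in\mathbb{R}^2$ be space-time points with $t_1\le t_2\le\dots\le t_n$ (speed of light $1$). The communication graph $G=([n],E)$ is the directed acyclic graph in which, for $j<k$, $(j,k)\in E$ iff $k$ lies in the future light cone of $j$, i.e. $|x_k-x_j|\le t_k-t_j$; there are no other edges. Challenges $c_j$ and responses $r_j$ take values in finite sets $C_j$ and $R_j$. Game $\mathcal{G}_1$. For $j=1,2,\dots,n$ in this order: $\mathcal{P}_j$ receives the messages sent to him by previous players; then receives $c_j$ and issues $r_j$; then may send a message (with values in an arbitrary finite set) to any player $\mathcal{P}_k$ with $(j,k)\in E$. A deterministic classical strategy specifies, for each $j$, the response $r_j$ and the messages sent by $\mathcal{P}_j$ as deterministic functions of $c_j$ and the messages received by $\mathcal{P}_j$. Game $\mathcal{G}_2$. A deterministic classical strategy specifies, for each $j$, the response $r_j$ as a deterministic function of $(c_k)_{k\in\mathcal{S}_j}$. General classical strategies are convex combinations (via shared randomness) of deterministic ones. *)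

(* Defs.v *)
From HB Require Import structures.
From mathcomp Require Import all_boot all_order all_algebra.
From mathcomp Require Import boolp reals.
Set Implicit Arguments.
Unset Strict Implicit.
Unset Printing Implicit Defensive.
Import Order.TTheory GRing.Theory Num.Theory.
Local Open Scope ring_scope.

(* Players are indexed by 'I_n = {0, ..., n-1} rather than {1, ..., n}.       *)

Section CommunicationGraph.
Variables (R : realType) (n : nat) (x t : 'I_n -> R).

Definition edge (j k : 'I_n) : bool :=
  (j < k)%N && (`|x k - x j| <= t k - t j).

Definition known (j : 'I_n) : {set 'I_n} := j |: [set k | edge k j].

Lemma edge_lt (j k : 'I_n) (m : nat) : edge j k -> (k < m.+1)%N -> (j < m)%N.
Proof. by case/andP=> jk _ km; apply: leq_trans jk _. Qed.

End CommunicationGraph.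

Section Games.
Variables (R : realType) (n : nat) (x t : 'I_n -> R).
Variables (Chal Resp : 'I_n -> finType).

(* The tuple (F_1, ..., F_n): each response as a function of all challenges.  *)
Definition response_tuple : Type :=
  forall j : 'I_n, (forall k, Chal k) -> Resp j.

(* The message sets are part of the strategy, one for each pair of players;   *)
(* "no message" is represented by a value of the set (the set is a singleton  *)
(* when a player never sends anything).                                       *)
Record strategy1 := Strategy1 {
  message : 'I_n -> 'I_n -> finType;
  respond1 : forall j, Chal j ->
    (forall i, edge x t i j -> message i j) -> Resp j;
  send1 : forall j, Chal j ->
    (forall i, edge x t i j -> message i j) ->
    forall k, edge x t j k -> message j k }.

(* The messages sent by the players j < m when the players act in the order   *)
(* 0, 1, 2, ... on the challenges c; see sentE for the resulting equation.    *)
Fixpoint sent_upto (s : strategy1) (c : forall k, Chal k) (m : nat) :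
    forall j : 'I_n, (j < m)%N -> forall k, edge x t j k -> message s j k :=
  match m with
  | 0 => fun j (j_lt : (j < 0)%N) => False_rect _ (notF j_lt)
  | m'.+1 => fun j j_lt =>
      send1 (c j) (fun i ij => sent_upto s c (edge_lt ij j_lt) ij)
  end.

Definition sent (s : strategy1) (c : forall k, Chal k) (j k : 'I_n)
    (jk : edge x t j k) : message s j k :=
  sent_upto s c (ltn_ord j) jk.

Lemma sent_upto_irr (s : strategy1) (c : forall k, Chal k) (m1 m2 : nat)
    (j : 'I_n) (lt1 : (j < m1)%N) (lt2 : (j < m2)%N) (k : 'I_n)
    (jk : edge x t j k) :
  sent_upto s c lt1 jk = sent_upto s c lt2 jk.
Proof.
elim: m1 m2 j lt1 lt2 k jk => [//|m1 IH] [//|m2] j lt1 lt2 k jk /=.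
apply: (congr1 (fun b => send1 (c j) b jk)).
by apply: functional_extensionality_dep => i;
   apply: functional_extensionality_dep => ij; apply: IH.
Qed.

Lemma sentE (s : strategy1) (c : forall k, Chal k) (j k : 'I_n)
    (jk : edge x t j k) :
  sent s c jk = send1 (c j) (fun i ij => sent s c ij) jk.
Proof.
rewrite /sent (sent_upto_irr s c (ltn_ord j) (ltnSn j)) /=.
apply: (congr1 (fun b => send1 (c j) b jk)).
by apply: functional_extensionality_dep => i;
   apply: functional_extensionality_dep => ij; apply: sent_upto_irr.
Qed.

Definition realized_by1 (s : strategy1) : response_tuple :=
  fun j c => respond1 (c j) (fun i (ij : edge x t i j) => sent s c ij).

Definition realizable1 (F : response_tuple) : Prop :=
  exists s : strategy1, forall j c, F j c = realized_by1 s j c.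

Definition strategy2 : Type :=
  forall j, (forall k, k \in known x t j -> Chal k) -> Resp j.

Definition realized_by2 (s : strategy2) : response_tuple :=
  fun j c => s j (fun k _ => c k).

Definition realizable2 (F : response_tuple) : Prop :=
  exists s : strategy2, forall j c, F j c = realized_by2 s j c.

(* The conditional probabilities P(r | c) obtained as convex combinations of  *)
(* the deterministic strategies in D, the shared randomness being l : L.      *)
Definition convex_combination (D : response_tuple -> Prop)
    (P : (forall k, Chal k) -> (forall k, Resp k) -> R) : Prop :=
  exists (L : finType) (p : L -> R) (F : L -> response_tuple),
    [/\ forall l, 0 <= p l,
        \sum_l p l = 1,
        forall l, D (F l) &
        forall c r, P c r = \sum_(l | [forall j, F l j c == r j]) p l].

End Games.

(* Main.v *)
Require Import Defs.
From HB Require Import structures.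
From mathcomp Require Import all_boot all_order all_algebra.
From mathcomp Require Import boolp reals.
Set Implicit Arguments.
Unset Strict Implicit.
Unset Printing Implicit Defensive.
Import Order.TTheory GRing.Theory Num.Theory.
Local Open Scope ring_scope.

(* Given a strategy for the game without communication, every player sends    *)
(* his own challenge to all players in his future light cone. Conversely, by  *)
(* transitivity of the light-cone order the set S_j is closed under           *)
(* predecessors, so that player j can simulate, from the challenges in S_j    *)
(* alone, all the players whose messages can influence him.                   *)

(** Relayed messages tell player j nothing beyond the challenges in S_j: by induction along the time
    order, [simulateE] recovers every message sent inside a predecessor-closed set from the
    challenges there, and [known_closed] makes S_j such a set. For mixed strategies, the same
    weights serve in both games. *)

Section CommunicationGraphTheory.
Variables (R : realType) (n : nat) (x t : 'I_n -> R).

(** Time differences add up, while distances obey the triangle inequality. *)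
Lemma edge_trans : transitive (edge x t).
Proof.
move=> k i j /andP[ik xik] /andP[kj xkj]; apply/andP; split.
  exact: ltn_trans ik kj.
apply: le_trans (ler_distD (x k) _ _) _.
by rewrite -[leRHS](subrKA (t k)); apply: lerD.
Qed.

Lemma self_known (j : 'I_n) : j \in known x t j.
Proof. exact: setU11. Qed.

Lemma edge_known (i j : 'I_n) : edge x t i j -> i \in known x t j.
Proof. by move=> ij; rewrite !inE ij orbT. Qed.

Lemma known_closed (i k j : 'I_n) :
  edge x t i k -> k \in known x t j -> i \in known x t j.
Proof.
move=> ik; rewrite !inE => /predU1P[<-|kj]; first by rewrite ik orbT.
by rewrite (edge_trans ik kj) orbT.
Qed.

Lemma known_edge (k j : 'I_n) : k \in known x t j -> k != j -> edge x t k j.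
Proof. by rewrite !inE => /predU1P[->|//]; rewrite eqxx. Qed.

End CommunicationGraphTheory.

Section Realizability.
Variables (R : realType) (n : nat) (x t : 'I_n -> R).
Variables (Chal Resp : 'I_n -> finType).

Section Simulation.
Variables (s : strategy1 x t Chal Resp) (A : {set 'I_n}).
Hypothesis A_closed : forall i k, edge x t i k -> k \in A -> i \in A.

(* Extending v to all players and running s is not an option: some Chal k     *)
(* with k outside A may be empty.                                             *)
Fixpoint simulate (v : forall k, k \in A -> Chal k) (m : nat) :
    forall j : 'I_n, (j < m)%N -> j \in A ->
    forall k, edge x t j k -> message s j k :=
  match m with
  | 0 => fun j (j_lt : (j < 0)%N) => False_rect _ (notF j_lt)
  | m'.+1 => fun j j_lt jA =>
      send1 (v j jA)
        (fun i ij => simulate v (edge_lt ij j_lt) (A_closed ij jA) ij)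
  end.

(** Both recursions unfold alike, and every sender into j is strictly earlier and stays in [A]. *)
Lemma simulateE (c : forall k, Chal k) (m : nat) (j : 'I_n) (j_lt : (j < m)%N)
    (jA : j \in A) (k : 'I_n) (jk : edge x t j k) :
  simulate (fun k _ => c k) j_lt jA jk = sent_upto s c j_lt jk.
Proof.
elim: m j j_lt jA k jk => [//|m IH] j j_lt jA k jk /=.
apply: (congr1 (fun b => send1 (c j) b jk)).
by apply: functional_extensionality_dep => i;
   apply: functional_extensionality_dep => ij; apply: IH.
Qed.

End Simulation.

Lemma realizable1_realizable2 (F : response_tuple Chal Resp) :
  realizable1 x t F -> realizable2 x t F.
Proof.
case=> s FE.
pose closed j i k (ik : edge x t i k) := @known_closed R n x t i k j ik.
exists (fun j v => respond1 (v j (self_known x t j)) (fun i ij =>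
  simulate s (@closed j) v (ltn_ord i) (edge_known ij) ij)) => j c.
rewrite FE /realized_by1 /realized_by2.
apply: (congr1 (respond1 (c j))).
by apply: functional_extensionality_dep => i;
   apply: functional_extensionality_dep => ij; rewrite simulateE.
Qed.

(** Player j's own challenge comes from no message, so it is transported along [k = j]. *)
Definition collect (j : 'I_n) (cj : Chal j)
    (m : forall i, edge x t i j -> Chal i) (k : 'I_n)
    (kj : k \in known x t j) : Chal k :=
  match eqVneq k j with
  | EqNotNeq k_eq_j => ecast i (Chal i) (esym k_eq_j) cj
  | NeqNotEq k_neq_j => m k (known_edge kj k_neq_j)
  end.

Lemma collectE (c : forall k, Chal k) (j k : 'I_n) (kj : k \in known x t j) :
  collect (c j) (fun i _ => c i) kj = c k.
Proof. by rewrite /collect; case: eqVneq => // k_eq_j; case: _ / k_eq_j kj. Qed.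

Definition broadcast (s : strategy2 x t Chal Resp) : strategy1 x t Chal Resp :=
  @Strategy1 R n x t Chal Resp (fun i _ => Chal i)
    (fun j cj m => s j (collect cj m)) (fun j cj _ _ _ => cj).

Lemma realizable2_realizable1 (F : response_tuple Chal Resp) :
  realizable2 x t F -> realizable1 x t F.
Proof.
case=> s FE; exists (broadcast s) => j c.
rewrite FE /realized_by1 /realized_by2 /=.
apply: (congr1 (s j)).
apply: functional_extensionality_dep => k;
  apply: functional_extensionality_dep => kj.
(* It remains to see that the messages actually sent are the challenges themselves. *)
rewrite -[LHS](collectE c kj); apply: (congr1 (fun m => collect (c j) m kj)).
by apply: functional_extensionality_dep => i;
   apply: functional_extensionality_dep => ij; rewrite sentE.
Qed.

Lemma convex_combinationS (D D' : response_tuple Chal Resp -> Prop)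
    (P : (forall k, Chal k) -> (forall k, Resp k) -> R) :
  (forall F, D F -> D' F) -> convex_combination D P -> convex_combination D' P.
Proof.
by move=> DD' [L [p [F [p0 p1 DF PE]]]]; exists L, p, F; split=> // l; apply: DD'.
Qed.

End Realizability.

Theorem mainTheorem4 (R : realType) (n : nat) (n_ge1 : (1 <= n)%N)
    (x t : 'I_n -> R)
    (t_sorted : forall j k : 'I_n, (j <= k)%N -> t j <= t k)
    (Chal Resp : 'I_n -> finType) :
  (forall F : response_tuple Chal Resp,
     realizable1 x t F <-> realizable2 x t F) /\
  (forall P : (forall k, Chal k) -> (forall k, Resp k) -> R,
     convex_combination (@realizable1 R n x t Chal Resp) P <->
     convex_combination (@realizable2 R n x t Chal Resp) P).
Proof.
split=> [F|P]; split.
- exact: realizable1_realizable2.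
- exact: realizable2_realizable1.
- exact/convex_combinationS/realizable1_realizable2.
- exact/convex_combinationS/realizable2_realizable1.
Qed.
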